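(* Let $G=(V,E)$ be a finite connected simple undirected graph, $uv\notin E$ with $u\neq v$, and $s\in V$. For nonempty $S\subseteq V\setminus\{s\}$ put $B=V\setminus S$, $K_S=(L[B,B])^{-1}$, $\varepsilon_S=(-1)^{|S|+1}$, and, with all vectors restricted to $B$, $$\rho_S=b^{\mathsf T}K_Sb,\quad \eta_S=e_s^{\mathsf T}K_Sa,\quad \alpha_S=e_s^{\mathsf T}K_Sb,\quad \beta_S=b^{\mathsf T}K_Sd,\quad \gamma_S=b^{\mathsf T}K_Sa,$$ $$A_S=\eta_S-\alpha_S\beta_S,\qquad B_S=\rho_S\eta_S-\alpha_S\gamma_S.$$ Define $$\ell_s=\sum_{S:\ \rho_S>0}\varepsilon_S\frac{B_S}{\rho_S},\qquad c_{s,\rho}=\sum_{S:\ \rho_S=\rho}\varepsilon_S\frac{A_S\rho_S-B_S}{\rho_S}\quad(\rho>0),$$ the sums being over nonempty $S\subseteq V\setminus\{s\}$, and let $\mathcal R_s$ be the set of distinct positive values $\rho$ taken by $\rho_S$ for which $c_{s,\rho}\neq0$. Then, for $\lambda>0$ and hence as rational functions of $\lambda$, $$\frac{f_s(\lambda)-f_s(0)}{\lambda}=\ell_s+\sum_{\rho\in\mathcal R_s}\frac{c_{s,\rho}}{1+\rho\lambda}.$$ Every pole of this rational function is simple and lies on the negative real axis.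
   Context: $G_\lambda$ denotes the weighted graph obtained from $G$ by giving every edge of $G$ conductance $1$ and adding the edge $uv$ with conductance $\lambda\ge 0$; the random walk on $G_\lambda$ moves along an incident edge with probability proportional to its conductance. $f_s(\lambda)$ is the expected cover time of this walk started at $s$, i.e. the expected first time at which all vertices of $V$ have been visited (the start is visited at time $0$). $L=D-A$ is the graph Laplacian of $G$, $L[B,B]$ its principal submatrix on $B$ (invertible when $S=V\setminus B$ is nonempty), $d$ is the vector of degrees in $G$, $e_x$ is the standard basis vector at $x$, $a=e_u+e_v$, $b=e_u-e_v$. *)

(* Defs.v *)
From HB Require Import structures.
From mathcomp Require Import all_boot all_order all_algebra.
From mathcomp Require Import all_classical all_reals all_analysis.
From mathcomp Require Import complex.

Set Implicit Arguments.
Unset Strict Implicit.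
Unset Printing Implicit Defensive.

Import Order.TTheory GRing.Theory Num.Theory.
Import numFieldNormedType.Exports.

Local Open Scope classical_set_scope.
Local Open Scope ring_scope.

Notation "x %:F" := (@FracField.tofrac _ x) : ring_scope.

Section RandomWalk.
Context {R : realType} {V : finType}.

(* The Markov property is stated with the conditional probability cleared of
   its denominator, so that histories of probability zero need no special
   treatment. *)
Definition is_random_walk (c : V -> V -> R) (s : V)
    d (T : measurableType d) (P : probability T R) (X : nat -> T -> V) : Prop :=
  [/\ forall n x, measurable [set w | X n w = x],
      P [set w | X 0%N w = s] = 1%E &
      forall n (h : nat -> V) y,
        P [set w | (forall i, (i <= n)%N -> X i w = h i) /\ X n.+1 w = y] =
        (P [set w | forall i, (i <= n)%N -> X i w = h i]
         * (c (h n) y / \sum_z c (h n) z)%:E)%E].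

(* Equal to +oo on trajectories that miss a vertex. *)
Definition cover_time (T : Type) (X : nat -> T -> V) (w : T) : \bar R :=
  ereal_inf [set n%:R%:E | n in
    [set n : nat | forall x, exists2 i, (i <= n)%N & X i w = x]].

Definition is_expected_cover_time (c : V -> V -> R) (s : V) (m : \bar R) : Prop :=
  exists d (T : measurableType d) (P : probability T R) (X : nat -> T -> V),
    is_random_walk c s P X /\ m = (\int[P]_w cover_time X w)%E.

End RandomWalk.

Section Graph.
Context (R : realType) {V : finType}.
Variables (E : rel V) (u v s : V).

Definition conductance (lambda : R) (x y : V) : R :=
  (E x y)%:R + lambda * (((x == u) && (y == v)) || ((x == v) && (y == u)))%:R.

Definition degree (x : V) : R := #|[set y | E x y]|%:R.

Definition laplacian (x y : V) : R := degree x * (x == y)%:R - (E x y)%:R.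

Definition lap_sub (B : {set V}) : 'M[R]_#|B| :=
  \matrix_(i, j) laplacian (enum_val i) (enum_val j).

Definition restr (B : {set V}) (f : V -> R) : 'cV[R]_#|B| :=
  \col_i f (enum_val i).

Definition e_ (x : V) : V -> R := fun y => (y == x)%:R.
Definition a_ : V -> R := fun y => e_ u y + e_ v y.
Definition b_ : V -> R := fun y => e_ u y - e_ v y.

(* f^T K_S g with K_S = (L[B,B])^-1 and B = V \ S *)
Definition formK (S : {set V}) (f g : V -> R) : R :=
  ((restr (~: S) f)^T *m invmx (lap_sub (~: S)) *m restr (~: S) g) 0 0.

Definition rhoS (S : {set V}) : R := formK S b_ b_.
Definition etaS (S : {set V}) : R := formK S (e_ s) a_.
Definition alphaS (S : {set V}) : R := formK S (e_ s) b_.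
Definition betaS (S : {set V}) : R := formK S b_ degree.
Definition gammaS (S : {set V}) : R := formK S b_ a_.
Definition AS (S : {set V}) : R := etaS S - alphaS S * betaS S.
Definition BS (S : {set V}) : R := rhoS S * etaS S - alphaS S * gammaS S.
Definition epsS (S : {set V}) : R := (-1) ^+ #|S|.+1.

Definition admissible : {set {set V}} :=
  [set S : {set V} | (S != finset.set0) && (S \subset [set~ s]%SET)].

Definition ell : R := \sum_(S in admissible | 0 < rhoS S) epsS S * (BS S / rhoS S).

Definition coef (rho : R) : R :=
  \sum_(S in admissible | rhoS S == rho)
    epsS S * ((AS S * rhoS S - BS S) / rhoS S).

(* The set of distinct values, as a duplicate-free sequence. *)
Definition Rs : seq R :=
  [seq rho <- undup [seq rhoS B | B in admissible] | (0 < rho) && (coef rho != 0)].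

Definition partial_fractions : {fraction {poly R}} :=
  (ell%:P)%:F + \sum_(rho <- Rs) (coef rho)%:P%:F / (1 + rho *: 'X)%:F.

End Graph.

Section RationalFunctions.
Context {R : realType}.

Definition agrees_on_pos (F : {fraction {poly R}}) (g : R -> \bar R) : Prop :=
  exists p q : {poly R}, F = p%:F / q%:F /\
    forall x, 0 < x -> q.[x] != 0 /\ g x = (p.[x] / q.[x])%:E.

(* z is a complex pole of order k > 0: a zero of multiplicity k of the
   denominator of F written in lowest terms. *)
Definition is_pole (F : {fraction {poly R}}) (z : R[i]) (k : nat) : Prop :=
  exists p q : {poly R},
    [/\ q != 0, coprimep p q, F = p%:F / q%:F, (0 < k)%N &
        mup z (map_poly (real_complex R) q) = k].

End RationalFunctions.

(* Main.v *)
(* Since L_lambda = L + lambda b b^T, the Sherman-Morrison formula gives the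
   expected hitting time h_S of S for the walk on G_lambda in closed form:
   h_S(s) has a single pole in lambda, at -1/rho_S, and
   (h_S(lambda) - h_S(0)) / lambda = (A_S + lambda B_S) / (1 + lambda rho_S).
   Here rho_S >= 0 because L[B,B] is positive definite on a connected graph, and
   rho_S = 0 forces u, v in S, which kills the term. The cover time is the
   maximum of the hitting times of the vertices other than s, so by
   inclusion-exclusion its tail is the eps_S-weighted sum of the tails of the
   hitting times of the sets S.

   To see that the expected hitting time of S is the solution of
   g = 1 + Q g off S, g = 0 on S, one telescopes the mass of the killed walk
   against g: sum_(n < N) P(T_S > n) = g(s) - sum_y m_N(y) g(y), where m_N
     is the
   law of the walk killed on S. The remainder is at most C P(T_S > N), and since
   these probabilities decrease while their partial sums stay bounded by 2 C,
   P(T_S > N) <= 2 C / (N + 1). *)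
Require Import Defs.
From HB Require Import structures.
From mathcomp Require Import all_boot all_order all_algebra.
From mathcomp Require Import all_classical all_reals all_analysis.
From mathcomp Require Import complex.
From mathcomp Require Import ring.
Import Order.TTheory GRing.Theory Num.Theory.
Import numFieldNormedType.Exports.
Local Open Scope ring_scope.

Set Implicit Arguments.
Unset Strict Implicit.
Unset Printing Implicit Defensive.

(** * Dirichlet form and Green function *)

Section DirichletForm.
Variables (R : realType) (V : finType) (E : rel V).
Hypotheses (Esym : symmetric E) (Econn : forall x y : V, connect E x y).
Implicit Types (S : {set V}) (f h : V -> R).

Definition lap f (x : V) : R := \sum_y laplacian R E x y * f y.

Lemma degreeE x : degree R E x = \sum_y (E x y)%:R.
Proof.
rewrite /degree -sum1_card natr_sum big_mkcond /=.
apply: eq_bigr => y _.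
have -> : (y \in [set z | E x z]%classic) = E x y by apply/idP/idP;
  rewrite in_setE.
by case: (E x y).
Qed.

Lemma laplacianC x y : laplacian R E x y = laplacian R E y x.
Proof.
rewrite /laplacian (eq_sym y) (Esym y); congr (_ - _).
by case: eqP => [->|]; rewrite ?mulr0.
Qed.

Lemma lapE f x : lap f x = \sum_y (E x y)%:R * (f x - f y).
Proof.
rewrite /lap /laplacian; under eq_bigr do rewrite mulrBl.
under [RHS]eq_bigr do rewrite mulrBr.
rewrite !sumrB -mulr_suml -degreeE; congr (_ - _).
rewrite (bigD1 x) //= eqxx mulr1 big1 ?addr0 // => y.
by rewrite eq_sym => /negbTE->; rewrite mulr0 mul0r.
Qed.

(** By symmetry of [E] the sum can also be written with x and y exchanged; adding the two forms
    completes the square edge by edge. *)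
Lemma dirichlet f :
  (\sum_x f x * lap f x) *+ 2 = \sum_x \sum_y (E x y)%:R * (f x - f y) ^+ 2.
Proof.
have half1 : \sum_x f x * lap f x =
    \sum_x \sum_y (E x y)%:R * (f x * (f x - f y)).
  by apply: eq_bigr => x _; rewrite lapE mulr_sumr; apply: eq_bigr => y _; ring.
have half2 : \sum_x f x * lap f x =
    \sum_x \sum_y (E x y)%:R * (f y * (f y - f x)).
  rewrite half1 exchange_big; apply: eq_bigr => x _; apply: eq_bigr => y _.
  by rewrite Esym.
rewrite mulr2n {1}half1 half2 -big_split; apply: eq_bigr => x _ /=.
by rewrite -big_split; apply: eq_bigr => y _ /=; ring.
Qed.

Lemma dirichlet_ge0 f : 0 <= \sum_x f x * lap f x.
Proof.
rewrite -(pmulrn_lge0 _ (ltn0Sn 1)) dirichlet.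
by apply: sumr_ge0 => x _; apply: sumr_ge0 => y _; rewrite mulr_ge0 ?sqr_ge0.
Qed.

(** Zero energy makes [f] constant along every edge, and a path from any vertex to a point of [S]
    carries the value 0 back. *)
Lemma dirichlet_eq0 S f : S != finset.set0 -> {in S, forall x, f x = 0} ->
  \sum_x f x * lap f x = 0 -> forall x, f x = 0.
Proof.
move=> /finset.set0Pn[z zS] fS f0 x.
have ge0 (i j : V) : 0 <= (E i j)%:R * (f i - f j) ^+ 2.
  by rewrite mulr_ge0 ?sqr_ge0.
have edge i j : E i j -> f i = f j.
  move=> Eij; apply/eqP; rewrite -subr_eq0 -sqrf_eq0.
  have := dirichlet f; rewrite f0 mul0rn => /esym/eqP.
  rewrite psumr_eq0 => [/allP/(_ i (mem_index_enum i))/=|k _];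
    last exact: sumr_ge0.
  rewrite psumr_eq0 => [/allP/(_ j (mem_index_enum j))/=|//].
  by rewrite Eij mul1r.
have /connectP[p] := Econn x z; elim: p x => [|y p IHp] x /=.
  by move=> _ <-; exact: fS.
by case/andP=> /edge-> pth; exact: IHp.
Qed.

(** The inner sum is the vector [w] extended by zero from B to V; pairings over V thus become
    pairings over the indices of the submatrix. *)
Lemma sum_enum_val (B : {set V}) (w : 'I_#|B| -> R) (F : V -> R) :
  \sum_x F x * \sum_i (enum_val i == x)%:R * w i = \sum_i F (enum_val i) * w i.
Proof.
under eq_bigr do rewrite mulr_sumr; rewrite exchange_big; apply: eq_bigr => i _.
rewrite (bigD1 (enum_val i)) //= eqxx mul1r big1 ?addr0 // => x.
by rewrite eq_sym => /negbTE->; rewrite mul0r mulr0.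
Qed.

(** A left-kernel vector extended by zero vanishes on [S] while its Laplacian vanishes off [S], so
    its Dirichlet energy is zero. *)
Lemma lap_sub_unit S : S != finset.set0 -> lap_sub R E (~: S) \in unitmx.
Proof.
move=> S0; rewrite unitmxE unitfE; apply/negP => /det0P[r r0 rL].
pose f x := \sum_(i < #|~: S|) (enum_val i == x)%:R * r 0 i.
have fi i : f (enum_val i) = r 0 i.
  rewrite /f (bigD1 i) //= eqxx mul1r big1 ?addr0 // => j ji.
  by rewrite (inj_eq enum_val_inj) (negbTE ji) mul0r.
suff f0 x : f x = 0.
  by case/eqP: r0; apply/rowP => i; rewrite -fi f0 mxE.
move: x; apply: (dirichlet_eq0 S0) => [x xS|].
  rewrite /f big1 // => i _.
  have := enum_valP i; rewrite inE; case: eqP => [->|]; last by rewrite mul0r.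
  by rewrite xS.
under eq_bigr do rewrite mulrC.
rewrite sum_enum_val big1 // => j _.
have -> : lap f (enum_val j) = (r *m lap_sub R E (~: S)) 0 j.
  rewrite /lap sum_enum_val mxE; apply: eq_bigr => i _.
  by rewrite mxE mulrC laplacianC.
by rewrite rL mxE mul0r.
Qed.

(** The potential K_S h, extended by zero to [S]: for x in [S] the restriction of e_x is the zero
    vector. *)
Definition green S h (x : V) : R := formK E S (e_ R x) h.

Lemma formK_sum S f h :
  formK E S f h = \sum_i f (enum_val i) *
    (invmx (lap_sub R E (~: S)) *m restr (~: S) h) i 0.
Proof.
by rewrite /formK -mulmxA mxE; apply: eq_bigr => i _; rewrite !mxE.
Qed.

Lemma formK_green S f h : formK E S f h = \sum_x f x * green S h x.
Proof.
under eq_bigr do rewrite /green formK_sum.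
by rewrite formK_sum -sum_enum_val.
Qed.

Lemma green_out S h x : x \in S -> green S h x = 0.
Proof.
move=> xS; rewrite /green formK_sum big1 // => i _; rewrite /e_.
have := enum_valP i; rewrite inE; case: eqP => [->|]; last by rewrite mul0r.
by rewrite xS.
Qed.

(** Since the potential vanishes on [S], off [S] the full Laplacian acts on it as the submatrix
    does, which undoes the inverse. *)
Lemma lap_green S h x : S != finset.set0 -> x \notin S ->
  lap (green S h) x = h x.
Proof.
move=> S0 xS; have xB : x \in ~: S by rewrite inE.
rewrite -(enum_rankK_in xB xB); set i := enum_rank_in _ _.
rewrite /lap; under eq_bigr do rewrite /green formK_sum.
rewrite sum_enum_val.
have <- : restr (~: S) h i 0 = h (enum_val i) by rewrite mxE.
rewrite -[restr _ h in RHS](mulKVmx (lap_sub_unit S0)) [RHS]mxE.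
by apply: eq_bigr => j _; rewrite [lap_sub _ _ _ i j]mxE.
Qed.

Lemma formKD S f h1 h2 :
  formK E S f (fun x => h1 x + h2 x) = formK E S f h1 + formK E S f h2.
Proof.
rewrite /formK; have -> : restr (~: S) (fun x => h1 x + h2 x) =
  restr (~: S) h1 + restr (~: S) h2 by apply/colP => i; rewrite !mxE.
by rewrite mulmxDr mxE.
Qed.

Lemma formKZ S f c h :
  formK E S f (fun x => c * h x) = c * formK E S f h.
Proof.
rewrite /formK; have -> : restr (~: S) (fun x => c * h x) =
  c *: restr (~: S) h by apply/colP => i; rewrite !mxE.
by rewrite -scalemxAr mxE.
Qed.

Lemma formK_eq0 S f h : {in ~: S, forall x, h x = 0} -> formK E S f h = 0.
Proof.
move=> h0; rewrite /formK; have -> : restr (~: S) h = 0.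
  by apply/colP => i; rewrite !mxE h0 ?enum_valP.
by rewrite mulmx0 mxE.
Qed.

(** Rewriting the quadratic form as a Dirichlet energy is what yields its positivity and
    definiteness. *)
Lemma formK_energy S h : S != finset.set0 ->
  formK E S h h = \sum_x green S h x * lap (green S h) x.
Proof.
move=> S0; rewrite formK_green; apply: eq_bigr => x _.
have [xS|xS] := boolP (x \in S); first by rewrite green_out // mulr0 mul0r.
by rewrite lap_green // mulrC.
Qed.

Lemma formK_ge0 S h : S != finset.set0 -> 0 <= formK E S h h.
Proof. by move=> S0; rewrite formK_energy // dirichlet_ge0. Qed.

Lemma formK_definite S h : S != finset.set0 -> formK E S h h = 0 ->
  {in ~: S, forall x, h x = 0}.
Proof.
move=> S0; rewrite formK_energy // => e0 x; rewrite inE => xS.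
rewrite -(lap_green h S0 xS) /lap big1 // => y _.
by rewrite (dirichlet_eq0 S0 _ e0) ?mulr0 // => z; exact: green_out.
Qed.

End DirichletForm.

(** * Adding the edge uv: a rank-one perturbation of the Laplacian *)

Section Perturbation.
Variables (R : realType) (V : finType) (E : rel V) (u v : V).
Hypotheses (Esym : symmetric E).
Hypotheses (Econn : forall x y : V, connect E x y) (neq_uv : u != v).
Local Notation c := (conductance E u v).
Local Notation a := (a_ R u v).
Local Notation b := (b_ R u v).

Lemma sum_e_ (x : V) (f : V -> R) : \sum_y e_ R x y * f y = f x.
Proof.
rewrite (bigD1 x) //= /e_ eqxx mul1r big1 ?addr0 // => y /negbTE->.
by rewrite mul0r.
Qed.

Lemma conductance_sum (l : R) (f : V -> R) x :
  \sum_y c l x y * f y =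
  \sum_y (E x y)%:R * f y + l * (e_ R u x * f v + e_ R v x * f u).
Proof.
rewrite /conductance; under eq_bigr do rewrite mulrDl -mulrA.
rewrite big_split -mulr_sumr /=; congr (_ + _ * _).
(* The two orientations of uv exclude each other, so the indicator of the disjunction splits as a
   sum. *)
have uvx : (x == u) && (x == v) = false.
  by apply/negP => /andP[/eqP->]; exact/negP.
under eq_bigr => y _.
  have -> : ((x == u) && (y == v) || (x == v) && (y == u))%:R * f y =
      e_ R u x * (e_ R v y * f y) + e_ R v x * (e_ R u y * f y).
    rewrite /e_; move: uvx; case: (x == u); case: (x == v) => //= _;
    by case: (y == v); case: (y == u); rewrite /=; ring.
  over.
by rewrite big_split -!mulr_sumr /= !sum_e_.
Qed.

Lemma conductance_degree (l : R) x :
  \sum_y c l x y = degree R E x + l * a x.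
Proof.
have := conductance_sum l (fun=> 1) x; under eq_bigr do rewrite mulr1.
under [in X in _ = X -> _]eq_bigr do rewrite mulr1.
by move=> ->; rewrite -degreeE /a_ !mulr1.
Qed.

(** As u and v differ, some vertex is distinct from [x]; the first edge of a path to it makes the
    degree of [x] positive. *)
Lemma conductance_degree_gt0 (l : R) x : 0 <= l -> 0 < \sum_y c l x y.
Proof.
move=> l0; rewrite conductance_degree ltr_pwDl ?mulr_ge0 ?addr_ge0 //.
have [y xy] : exists y, x != y.
  by have [->|] := eqVneq x u; [exists v | exists u].
have /connectP[[|z p]] /= := Econn x y; first by move=> _ yx;
  rewrite yx eqxx in xy.
case/andP=> xz _ _; rewrite degreeE (bigD1 z) //= xz ltr_pwDl //.
by apply: sumr_ge0.
Qed.

(* The Laplacian of G_lambda is L + lambda b b^T. *)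
Lemma conductance_laplacian (l : R) (f : V -> R) x :
  (\sum_y c l x y) * f x - \sum_y c l x y * f y =
  lap E f x + l * b x * \sum_y b y * f y.
Proof.
have bf : \sum_y b y * f y = f u - f v.
  by rewrite /b_; under eq_bigr do rewrite mulrBl; rewrite sumrB !sum_e_.
rewrite conductance_degree conductance_sum bf lapE.
under [in RHS]eq_bigr do rewrite mulrBr.
rewrite sumrB -mulr_suml -degreeE /a_ /b_ /e_.
have [->|xu] := eqVneq x u;
  first by rewrite (negbTE neq_uv) /= mulr1n mulr0n; ring.
by have [->|xv] := eqVneq x v; rewrite /= ?mulr1n mulr0n; ring.
Qed.

(* Sherman-Morrison form of (L + lambda b b^T)[B,B]^-1 (d + lambda a). *)
Definition hitting (S : {set V}) (l : R) (x : V) : R :=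
  green E S (fun y => degree R E y + l * a y) x -
  l * green E S b x * formK E S b (fun y => degree R E y + l * a y) /
    (1 + l * formK E S b b).

Lemma hitting_out (S : {set V}) (l : R) x : x \in S -> hitting S l x = 0.
Proof. by move=> xS; rewrite /hitting !green_out // mulr0 !mul0r subr0. Qed.

(** Multiplied by the total conductance at [x], the equation reads (L + l b b^T) g = d + l a at
    [x]. *)
Lemma hitting_harmonic (S : {set V}) (l : R) x : S != finset.set0 -> 0 <= l
  -> x \notin S ->
  hitting S l x = 1 + \sum_y c l x y / (\sum_z c l x z) * hitting S l y.
Proof.
move=> S0 l0 xS; set D := \sum_z c l x z.
have D0 : D != 0 by rewrite gt_eqF // conductance_degree_gt0.
have r0 : 1 + l * formK E S b b != 0.
  by rewrite gt_eqF // ltr_pwDl // mulr_ge0 ?formK_ge0.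
apply: (mulfI D0); rewrite [RHS]mulrDr mulr1 mulr_sumr.
under eq_bigr => y _.
  have -> : D * (c l x y / D * hitting S l y) = c l x y * hitting S l y
    by field.
  over.
apply/eqP; rewrite -subr_eq conductance_laplacian; apply/eqP.
pose h y := degree R E y + l * a y.
(* This [k] solves k (1 + l b^T K b) = l b^T K h, so the term - k b produced by L cancels the
   rank-one term. *)
pose k := l * formK E S b h / (1 + l * formK E S b b).
have hE y : hitting S l y = green E S h y - k * green E S b y.
  by rewrite /hitting /k; ring.
have -> : lap E (hitting S l) x = lap E (green E S h) x - k * lap E (green E
  S b) x.
  rewrite /lap mulr_sumr -sumrB; apply: eq_bigr => y _.
  by rewrite hE; ring.
have -> : \sum_y b y * hitting S l y = formK E S b h - k * formK E S b b.
  rewrite !formK_green mulr_sumr -sumrB; apply: eq_bigr => y _.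
  by rewrite hE; ring.
rewrite !lap_green // {1}/h -conductance_degree /k -/D.
by field.
Qed.

Definition quot_term (s : V) S (l : R) : R :=
  (AS R E u v s S + l * BS R E u v s S) / (1 + l * rhoS R E u v S).

(** The part e_s^T K_S d cancels; over the denominator 1 + l rho the rest is l (eta (1 + l rho) -
    alpha (beta + l gamma)), which regroups as l (A + l B). *)
Lemma hitting_quot (S : {set V}) s (l : R) : S != finset.set0 -> 0 <= l ->
  hitting S l s - hitting S 0 s = l * quot_term s S l.
Proof.
move=> S0 l0.
have r0 : 1 + l * formK E S b b != 0.
  by rewrite gt_eqF // ltr_pwDl // mulr_ge0 ?formK_ge0.
rewrite /quot_term /hitting /AS /BS /rhoS /etaS /alphaS /betaS /gammaS /green.
have hE f k : formK E S f (fun y => degree R E y + k * a y) =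
    formK E S f (degree R E) + k * formK E S f a by rewrite formKD formKZ.
rewrite !hE; field.
by [].
Qed.

(** Definiteness makes b vanish off [S], so u and v lie in [S] and a vanishes off [S] too; this
    kills eta, alpha and gamma. *)
Lemma quot_term_rho0 s (S : {set V}) (l : R) : S != finset.set0 -> s \notin S ->
  rhoS R E u v S = 0 -> quot_term s S l = 0.
Proof.
move=> S0 sS rho0.
have b0 := formK_definite Esym Econn S0 rho0.
have uS : u \in S.
  apply: contraT => uS; have := b0 u; rewrite inE uS => /(_ isT)/eqP.
  by rewrite /b_ /e_ eqxx (negbTE neq_uv) subr0 oner_eq0.
have vS : v \in S.
  apply: contraT => vS; have := b0 v; rewrite inE vS => /(_ isT)/eqP.
  by rewrite /b_ /e_ eqxx (eq_sym v) (negbTE neq_uv) sub0r oppr_eq0 oner_eq0.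
have a0 : {in ~: S, forall x, a x = 0}.
  move=> x; rewrite inE /a_ /e_ => xS.
  have [xu|_] := eqVneq x u; first by rewrite xu uS in xS.
  have [xv|_] := eqVneq x v; first by rewrite xv vS in xS.
  by rewrite addr0.
rewrite /quot_term /AS /BS /etaS /alphaS /gammaS.
by rewrite !(formK_eq0 E _ b0) !(formK_eq0 E _ a0) !(mulr0, mul0r, subr0,
  addr0).
Qed.

End Perturbation.

(** * Partial fractions *)

Lemma tofrac_add_div (D : idomainType) (a x p y : D) : x != 0 -> y != 0 ->
  a%:F / x%:F + p%:F / y%:F = (p * x + a * y)%:F / (x * y)%:F.
Proof.
move=> x0 y0; rewrite addf_div ?tofrac_eq0 //.
by rewrite -!tofracM -tofracD addrC.
Qed.

Section PartialFractions.
Variables (R : realType) (c : R) (k : R -> R).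

Definition pole_den (r : seq R) : {poly R} := \prod_(rho <- r) (1 + rho *: 'X).

Definition pf_sum (r : seq R) : {fraction {poly R}} :=
  c%:P%:F + \sum_(rho <- r) (k rho)%:P%:F / (1 + rho *: 'X)%:F.

Lemma horner_factor (rho x : R) : (1 + rho *: 'X).[x] = 1 + rho * x.
Proof. by rewrite !hornerE. Qed.

Lemma factor_gt0 (rho x : R) : 0 < rho -> 0 < x -> 0 < (1 + rho *: 'X).[x].
Proof. by move=> r0 x0; rewrite horner_factor ltr_pwDl // ltW // mulr_gt0. Qed.

Lemma pole_den_gt0 r x : all (> 0) r -> 0 < x -> 0 < (pole_den r).[x].
Proof.
move=> r0 x0; rewrite /pole_den horner_prod.
rewrite big_seq; apply: prodr_gt0 => rho /(allP r0) /= rho0.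
exact: factor_gt0.
Qed.

Lemma poly_pos_neq0 (q : {poly R}) : 0 < q.[1] -> q != 0.
Proof. by apply: contraTneq => ->; rewrite horner0 ltxx. Qed.

(** By induction on [r], a single numerator over [pole_den] serves both the identity of fractions
    and the evaluation at positive points, where no factor vanishes. *)
Lemma pf_sum_frac r : all (> 0) r ->
  exists p : {poly R}, pf_sum r = p%:F / (pole_den r)%:F /\
    forall x, 0 < x ->
      p.[x] / (pole_den r).[x] = c + \sum_(rho <- r) k rho / (1 + rho * x).
Proof.
elim: r => [_|rho r IHr /= /andP[rho0 r0]].
  exists c%:P; rewrite /pf_sum /pole_den !big_nil tofrac1 divr1 addr0.
  by split=> // x x0; rewrite big_nil addr0 !hornerE divr1.
have [p [pE pv]] := IHr r0.
exists (p * (1 + rho *: 'X) + (k rho)%:P * pole_den r).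
have denE : pole_den (rho :: r) = (1 + rho *: 'X) * pole_den r.
  by rewrite /pole_den big_cons.
split.
  have f0 : 1 + rho *: 'X != 0 by rewrite poly_pos_neq0 // factor_gt0.
  have d0 : pole_den r != 0 by rewrite poly_pos_neq0 // pole_den_gt0.
  have -> : pf_sum (rho :: r) = (k rho)%:P%:F / (1 + rho *: 'X)%:F + pf_sum r.
    by rewrite /pf_sum big_cons addrCA.
  by rewrite pE denE; exact: tofrac_add_div.
move=> x x0; rewrite big_cons addrCA -pv // denE.
have := factor_gt0 rho0 x0; have := pole_den_gt0 r0 x0.
rewrite -horner_factor (hornerD (p * _)) !hornerM hornerC.
move: (horner (1 + _) x) (horner (pole_den r) x) =>
  X Y /gt_eqF/negbT X0 /gt_eqF/negbT Y0.
by field; rewrite X0.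
Qed.

Lemma poly_eq_on_pos (p q : {poly R}) :
  (forall x, 0 < x -> p.[x] = q.[x]) -> p = q.
Proof.
move=> pq; apply/eqP; rewrite -subr_eq0; apply/eqP.
(* The positive points 1, 2, ... are distinct roots of the difference, as many as its size, which
   forces it to be zero. *)
apply: (@roots_geq_poly_eq0 _ _ [seq i.+1%:R | i <- iota 0 (size (p - q))]).
- by apply/allP => _ /mapP[i _ ->]; rewrite /root !hornerE pq ?subrr.
- rewrite map_inj_uniq ?iota_uniq // => i j /eqP.
  by rewrite eqr_nat => /eqP[].
- by rewrite size_map size_iota.
Qed.

(** A rational function is determined by its values on the positive reals: the cross products of two
    fractions agreeing there are equal polynomials. *)
Lemma agrees_on_posP r (g : R -> \bar R) : all (> 0) r ->
  (forall x, 0 < x -> g x = (c + \sum_(rho <- r) k rho / (1 + rho * x))%:E) ->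
  forall F : {fraction {poly R}}, agrees_on_pos F g <-> F = pf_sum r.
Proof.
move=> r0 gE F; have [p [pE pv]] := pf_sum_frac r0.
have den0 x : 0 < x -> (pole_den r).[x] != 0.
  by move=> x0; rewrite gt_eqF // pole_den_gt0.
split=> [[p' [q' [-> pq']]]|->]; last first.
  by exists p, (pole_den r); split=> // x x0; rewrite den0 // gE // pv.
have q'0 : q' != 0.
  have [+ _] := pq' 1 ltr01.
  by apply: contraNneq => ->; rewrite horner0.
apply/eqP; rewrite pE eqr_div ?tofrac_eq0 //; last first.
  by rewrite poly_pos_neq0 // pole_den_gt0.
rewrite -!tofracM tofrac_eq; apply/eqP/poly_eq_on_pos => x x0.
have [q'x0 gx] := pq' x x0; have := gE x x0.
rewrite gx -pv // => -[/eqP]; rewrite eqr_div ?den0 // => /eqP e.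
by rewrite !hornerM.
Qed.

Lemma mup_dvd (F : fieldType) (z : F) (p q : {poly F}) :
  q != 0 -> p %| q -> (mup z p <= mup z q)%N.
Proof.
move=> q0 /dvdpP[t qE]; move: q0; rewrite qE mulf_eq0 negb_or => /andP[t0 p0].
by rewrite mupM // leq_addl.
Qed.

(** [pole_den] is the nonzero constant prod rho times the product of the linear factors X +
    1/rho. *)
Lemma mup_pole_den r (z : R[i]) : all (> 0) r ->
  mup z (map_poly (real_complex R) (pole_den r)) =
  count_mem z [seq (- rho^-1)%:C%C | rho <- r].
Proof.
rewrite -mu_prod_XsubC big_map => r0.
have -> : map_poly (real_complex R) (pole_den r) =
    (\prod_(rho <- r) (real_complex R rho))%:P *
    \prod_(rho <- r) ('X - ((- rho^-1)%:C)%C%:P).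
  rewrite /pole_den rmorph_prod /= [X in polyC X]big_seq rmorph_prod /=.
  rewrite -big_seq -big_split /= [LHS]big_seq [RHS]big_seq.
  apply: eq_bigr => rho /(allP r0) /= rho0.
  rewrite rmorphD rmorph1 /= linearZ_LR /= map_polyX mulrBr -polyCM.
  rewrite -[real_complex R _ * _]rmorphM mulrN divff ?gt_eqF //.
  by rewrite rmorphN rmorph1 polyCN opprK addrC mul_polyC.
rewrite mupMr // rootC prodf_seq_neq0.
apply/allP => rho /(allP r0) /= rho0.
by rewrite fmorph_eq0 gt_eqF.
Qed.

(** By Gauss's lemma a reduced denominator divides [pole_den], whose roots -1/rho are pairwise
    distinct. *)
Lemma pole_pf_sum r (z : R[i]) m : all (> 0) r -> uniq r ->
  is_pole (pf_sum r) z m -> m = 1%N /\ z < 0.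
Proof.
move=> r0 ur [p [q [q0 pq FE m0 mE]]].
have [P [PE _]] := pf_sum_frac r0.
have den0 : pole_den r != 0 by rewrite poly_pos_neq0 // pole_den_gt0.
have qd : q %| pole_den r.
  move: FE; rewrite PE => /eqP; rewrite eqr_div ?tofrac_eq0 // -!tofracM.
  rewrite tofrac_eq => /eqP e.
  by rewrite -(@Gauss_dvdpr _ _ p) 1?coprimep_sym // -e dvdp_mull.
have : (m <= count_mem z [seq (- rho^-1)%:C%C | rho <- r])%N.
  by rewrite -mup_pole_den // -mE mup_dvd ?map_poly_eq0 // dvdp_map.
rewrite count_uniq_mem; last first.
  by rewrite map_inj_uniq // => x y [/oppr_inj/invr_inj].
case: mapP => [[rho rr zE]|_]; last by rewrite leqNgt m0.
move=> m1; split; first by apply/eqP; rewrite eqn_leq m1 m0.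
(* In the order of [R[i]], z < 0 means zero imaginary part and negative real part. *)
by rewrite zE ltcE /= eqxx oppr_lt0 invr_gt0 (allP r0).
Qed.

End PartialFractions.

(** * Inclusion-exclusion *)

Section InclusionExclusion.
Variables (R : realType) (V : finType).

(** Expand the product over all i of 1 - [i in U]: a subset not inside [U] contributes a zero
    factor, and the product itself vanishes once [U] has an element. *)
Lemma sum_subset_sign (U : {set V}) :
  \sum_(S : {set V} | S \subset U) (-1) ^+ #|S| = (U == finset.set0)%:R :> R.
Proof.
have := bigA_distr 1 (@GRing.add R) (fun i => - (i \in U)%:R) (fun=> 1).
move=> e; transitivity (\prod_i (- (i \in U)%:R + 1 : R)).
  rewrite e [RHS](bigID [pred S : {set V} | S \subset U]) /= [X in _ +
    X]big1 ?addr0 => [|S].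
    apply: eq_bigr => S SU.
    rewrite -big_mkcond /= -prodr_const; apply: eq_bigr => i iS.
    by rewrite (fintype.subsetP SU).
  by case/subsetPn => i iS iU; rewrite (bigD1 i) //= iS (negbTE iU) oppr0 mul0r.
have [->|/finset.set0Pn[i iU]] := eqVneq U finset.set0.
  by apply: big1 => i _; rewrite inE oppr0 add0r.
by rewrite (bigD1 i) //= iU addNr mul0r.
Qed.

(** Inside a [U] missing s, admissibility only excludes the empty set. [U] will be the set of
    vertices not yet visited. *)
Lemma sum_admissible_subset (s : V) (U : {set V}) : s \notin U ->
  \sum_(S in admissible s) epsS R S * (S \subset U)%:R = (U != finset.set0)%:R.
Proof.
move=> sU; transitivity (\sum_(S : {set V} | (S \subset U) && (S !=
  finset.set0)) - (-1) ^+ #|S| : R).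
  rewrite [LHS]big_mkcond [RHS]big_mkcond /=; apply: eq_bigr => S _.
  rewrite !inE /epsS; case SU: (S \subset U); last by rewrite mulr0 if_same.
  have -> : S \subset [set~ s].
    by apply/fintype.subsetP => x /(fintype.subsetP SU) xU; rewrite !inE;
      apply: contraNneq sU => <-.
  by rewrite andbT exprS mulN1r mulr1.
have := sum_subset_sign U;
  rewrite (bigD1 finset.set0) ?finset.sub0set //= cards0 expr0.
rewrite sumrN => /(canRL (addKr _)) ->; rewrite addrC opprD opprK.
by case: eqP => _ /=; rewrite !(mulr1n, mulr0n, oppr0, addNr, add0r).
Qed.

End InclusionExclusion.

(** * Grouping the sets S by the value of rho_S *)

Section PartialFractionExpansion.
Variables (R : realType) (V : finType) (E : rel V) (u v s : V).
Hypotheses (Esym : symmetric E) (Econn : forall x y : V, connect E x y).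
Hypothesis neq_uv : u != v.
Local Notation rho_ := (rhoS R E u v).
Local Notation term S := ((AS R E u v s S * rho_ S - BS R E u v s S) / rho_ S).

Lemma admissible_neq0 S : S \in admissible s -> S != finset.set0.
Proof. by rewrite inE => /andP[]. Qed.

Lemma admissible_notin S : S \in admissible s -> s \notin S.
Proof. by rewrite inE => /andP[_ /fintype.subsetP SV]; apply/negP => /SV;
  rewrite !inE eqxx. Qed.

(** Values with zero coefficient can be restored freely, after which each S with positive rho_S is
    counted under exactly one value. *)
Lemma sum_Rs (F : R -> R) :
  \sum_(rho <- Rs R E u v s) coef E u v s rho * F rho =
  \sum_(S in admissible s | 0 < rho_ S) epsS R S * term S * F (rho_ S).
Proof.
rewrite /Rs big_filter; set vals := undup _.
rewrite big_mkcondr /= (eq_bigr (fun rho => coef E u v s rho * F rho));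
  last first.
  by move=> rho _; case: eqP => //= ->; rewrite mul0r.
under eq_bigr do rewrite /coef mulr_suml.
rewrite (exchange_big_dep (fun S =>
  (S \in admissible s) && (0 < rho_ S))) /=; last first.
  by move=> rho S r0 /andP[-> /eqP->].
apply: eq_bigr => S /andP[SA S0]; rewrite SA big_mkcond /=.
have Sv : rho_ S \in vals by rewrite mem_undup fintype.image_f.
rewrite (bigD1_seq _ Sv) ?undup_uniq //= S0 eqxx big1 ?addr0 // => rho.
by rewrite eq_sym => /negbTE->; rewrite andbF.
Qed.

(** For rho > 0, (A + l B) / (1 + l rho) = B / rho + ((A rho - B) / rho) / (1 + rho l); the terms
    with rho = 0 vanish. *)
Lemma sum_quot_term (l : R) : 0 < l ->
  \sum_(S in admissible s) epsS R S * quot_term E u v s S l =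
  ell R E u v s + \sum_(rho <- Rs R E u v s) coef E u v s rho / (1 + rho * l).
Proof.
move=> l0; rewrite (sum_Rs (fun rho => (1 + rho * l)^-1)) /ell.
rewrite (bigID (fun S => 0 < rho_ S)) /= [X in _ + X]big1 ?addr0 =>
  [|S /andP[SA]].
  rewrite -big_split; apply: eq_bigr => S /andP[SA r0] /=.
  have r1 : 1 + rho_ S * l != 0
    by rewrite gt_eqF // ltr_pwDl // ltW // mulr_gt0.
  rewrite /quot_term; field.
  by rewrite r1 gt_eqF.
have S0 := admissible_neq0 SA.
rewrite lt_neqAle formK_ge0 // andbT negbK => /eqP rho0.
by rewrite quot_term_rho0 ?mulr0 // admissible_notin.
Qed.

Lemma Rs_gt0 : all (> 0) (Rs R E u v s).
Proof. by apply/allP => rho; rewrite mem_filter => /andP[/andP[]]. Qed.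

Lemma Rs_uniq : uniq (Rs R E u v s).
Proof. by rewrite filter_uniq // undup_uniq. Qed.

End PartialFractionExpansion.

(** * Hitting times *)

Section Fibres.
Local Open Scope classical_set_scope.
Context {R : realType} d (T : measurableType d) (P : probability T R).

Definition prob (A : set T) : R := fine (P A).
Local Notation pr := prob.

Lemma prK A : measurable A -> (pr A)%:E = P A.
Proof. by move=> mA; rewrite fineK // fin_num_measure. Qed.

Lemma pr_ge0 A : 0 <= pr A.
Proof. by rewrite fine_ge0. Qed.

Lemma le_pr A B : measurable A -> measurable B -> A `<=` B -> pr A <= pr B.
Proof.
by move=> mA mB AB; rewrite -lee_fin !prK // le_measure // inE.
Qed.

Lemma pr_set0 : pr set0 = 0.
Proof. by rewrite /prob measure0. Qed.

Context (I : finType) (H : T -> I).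
Hypothesis mH : forall i, measurable [set w | H w = i].

Lemma measurable_fibres (Q : pred I) : measurable [set w | Q (H w)].
Proof.
have -> : [set w | Q (H w)] = \bigcup_(i in [set` Q]) [set w | H w = i].
  by apply/seteqP; split=> [w Qw|w [i /= Qi Hw]] /=; [exists (H w)|rewrite Hw].
by apply: fin_bigcup_measurable => // i _; exact: mH.
Qed.

Lemma pr_fibres A : measurable A -> pr A = \sum_i pr (A `&` [set w | H w = i]).
Proof.
move=> mA.
have mAi i : measurable (A `&` [set w | H w = i]) by exact: measurableI.
apply: EFin_inj; rewrite prK // -sumEFin.
have AE : A = \bigcup_(i in [set` index_enum I]) (A `&` [set w | H w = i]).
  apply/seteqP; split=> [w Aw|w [i _ []]//].
  by exists (H w) => //=; exact: mem_index_enum.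
rewrite [in LHS]AE measure_fin_bigcup //.
- rewrite -fsbig_seq ?index_enum_uniq //.
  by apply: eq_bigr => i _; rewrite prK.
- by apply/trivIsetP => i j _ _ ij; apply/seteqP;
  split=> // w [[_ /= Hi] [_ /= Hj]]; rewrite -Hi -Hj eqxx in ij.
Qed.

Lemma pr_fibres_pred (Q : pred I) A : measurable A ->
  pr (A `&` [set w | Q (H w)]) = \sum_(i | Q i) pr (A `&` [set w | H w = i]).
Proof.
move=> mA; have mQ := measurable_fibres Q.
rewrite pr_fibres; last exact: measurableI.
rewrite [RHS]big_mkcond /=; apply: eq_bigr => i _.
case Qi : (Q i).
  by congr pr; apply/seteqP; split=> [w [[Aw _] <-]|w [Aw Hw]] //;
    split=> //; rewrite /= Hw.
rewrite -[RHS]pr_set0; congr pr; apply/seteqP; split=> // w [[_ /= QH] Hw].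
by move: Qi; rewrite -Hw QH.
Qed.

End Fibres.

(** * Finite histories and the walk killed on S *)

Section Walk.
Local Open Scope classical_set_scope.
Context {R : realType} {V : finType} (c : V -> V -> R) (s : V).
Context d (T : measurableType d) (P : probability T R) (X : nat -> T -> V).
Hypothesis walk : is_random_walk c s P X.
Local Notation pr := (prob P).

Definition transition x y := c x y / \sum_z c x z.

(** Paths up to time n live in a finite type, so events depending on them have probabilities given
    by finite sums. *)
Definition history n w : {ffun 'I_n.+1 -> V} := [ffun i : 'I_n.+1 => X i w].

Lemma mX n x : measurable [set w | X n w = x].
Proof. by case: walk. Qed.

Lemma historyP n h w :
  history n w = h <-> forall i, (i <= n)%N -> X i w = h (inord i).
Proof.
split=> [<- i lin|Xh]; first by rewrite ffunE inordK.
apply/ffunP => i; rewrite ffunE Xh; last by rewrite -ltnS ltn_ord.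
by rewrite inord_val.
Qed.

Lemma measurable_history n h : measurable [set w | history n w = h].
Proof.
have -> : [set w | history n w = h] =
    \bigcap_(i : 'I_n.+1) [set w | X i w = h i].
  apply/seteqP; split=> [w /= hw i _ /=|w hw /=]; first by rewrite -hw ffunE.
  by apply/ffunP => i; rewrite ffunE; exact: hw.
by apply: fin_bigcap_measurable => // i _; exact: mX.
Qed.

Lemma measurable_historyQ n (Q : pred {ffun 'I_n.+1 -> V}) :
  measurable [set w | Q (history n w)].
Proof. by apply: measurable_fibres; exact: measurable_history. Qed.

Lemma pr_historyQ n (Q : pred {ffun 'I_n.+1 -> V}) :
  pr [set w | Q (history n w)] = \sum_(h | Q h) pr [set w | history n w = h].
Proof.
have := pr_fibres_pred P (@measurable_history n) Q measurableT.
by rewrite setTI => ->; apply: eq_bigr => h _; rewrite setTI.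
Qed.

Lemma pr_history_next n h y :
  pr [set w | history n w = h /\ X n.+1 w = y] =
  pr [set w | history n w = h] * transition (h ord_max) y.
Proof.
have [_ _ /(_ n (fun i => h (inord i)) y)] := walk.
have -> : [set w | forall i, (i <= n)%N -> X i w = h (inord i)] =
    [set w | history n w = h] by apply/seteqP; split=> w /historyP.
have -> : [set w | (forall i, (i <= n)%N -> X i w = h (inord i)) /\ X n.+1 w
  = y] =
    [set w | history n w = h /\ X n.+1 w = y].
  by apply/seteqP; split=> w [/historyP hw Xy].
have -> : inord n = ord_max :> 'I_n.+1.
  by apply: val_inj; rewrite /= inordK.
rewrite -prK; last exact: (measurableI _ _ (measurable_history h) (mX n.+1 y)).
rewrite -prK; last exact: measurable_history.
by move=> -[].
Qed.

Lemma pr_historyQ_next n (Q : pred {ffun 'I_n.+1 -> V}) y :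
  pr [set w | Q (history n w) /\ X n.+1 w = y] =
  \sum_(h | Q h) pr [set w | history n w = h] * transition (h ord_max) y.
Proof.
have -> : [set w | Q (history n w) /\ X n.+1 w = y] =
  [set w | X n.+1 w = y] `&` [set w | Q (history n w)] by rewrite setIC.
rewrite (pr_fibres_pred P (@measurable_history n) Q (mX _ _)).
by apply: eq_bigr => h _; rewrite -pr_history_next setIC.
Qed.

(** The fibres of [X 0] have total probability 1, all of it already taken by s. *)
Lemma pr_start x : pr [set w | X 0%N w = x] = (x == s)%:R.
Proof.
have [_ P0 _] := walk.
have Ps : pr [set w | X 0%N w = s] = 1 by rewrite /prob P0.
have := pr_fibres P (mX 0) measurableT.
rewrite {1}/prob probability_setT /= (bigD1 s) //= setTI Ps.
have [->//|xs] := eqVneq x s.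
move/esym/eqP; rewrite -subr_eq0 addrAC subrr add0r.
rewrite psumr_eq0 => [/allP/(_ x (mem_index_enum x))|i _]; last exact: pr_ge0.
by rewrite xs setTI => /eqP.
Qed.

Section Avoid.
Variable S : {set V}.

Definition avoids n (h : {ffun 'I_n.+1 -> V}) : bool := [forall i, h i
  \notin S].

Definition survival n := pr [set w | avoids (history n w)].

(** The law at time n of the walk killed on [S], a measure of total mass [survival n]. *)
Definition mass n x :=
  pr [set w | avoids (history n w) && (history n w ord_max == x)].

Lemma mass_ge0 n x : 0 <= mass n x.
Proof. exact: pr_ge0. Qed.

Lemma survival_sum n : survival n = \sum_x mass n x.
Proof.
rewrite /survival pr_historyQ (partition_big (fun h : {ffun 'I_n.+1 -> V} =>
  h ord_max) xpredT) //=.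
by apply: eq_bigr => x _;
  rewrite /mass (pr_historyQ (fun h => avoids h && (h ord_max == x))).
Qed.

Lemma avoids_next n w : avoids (history n.+1 w) =
  avoids (history n w) && (X n.+1 w \notin S).
Proof.
apply/forallP/andP => [av|[/forallP av XS] i].
  split; last by have := av ord_max; rewrite ffunE.
  by apply/forallP => i; have := av (widen_ord (leqnSn _) i); rewrite !ffunE.
rewrite ffunE; have [lti|] := ltnP i n.+1.
  by have := av (Ordinal lti); rewrite ffunE.
move=> ni; have -> // : nat_of_ord i = n.+1.
by apply/eqP; rewrite eqn_leq ni -ltnS ltn_ord.
Qed.

Lemma survival_decr n : survival n.+1 <= survival n.
Proof.
apply: le_pr; [exact: measurable_historyQ|exact: measurable_historyQ|].
by move=> w /=; rewrite avoids_next => /andP[].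
Qed.

(** Grouping histories by their last vertex reduces this to the Markov property; the indicator
    performs the killing. *)
Lemma mass_next n y :
  mass n.+1 y = (y \notin S)%:R * \sum_x mass n x * transition x y.
Proof.
have [yS|yS] := boolP (y \in S); rewrite ?mul0r ?mul1r.
  rewrite -[RHS](pr_set0 P) /mass; congr pr; apply/seteqP; split=> // w /=.
  by rewrite avoids_next ffunE => /andP[/andP[_ XS] /eqP Xy]; move: XS;
    rewrite Xy yS.
have -> : mass n.+1 y = pr [set w | avoids (history n w) /\ X n.+1 w = y].
  rewrite /mass; congr pr; apply/seteqP; split=> w /=;
    rewrite avoids_next ffunE.
    by move=> /andP[/andP[-> _] /eqP->].
  by move=> [-> ->]; rewrite yS eqxx.
rewrite pr_historyQ_next (partition_big (fun h : {ffun 'I_n.+1 -> V} =>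
  h ord_max) xpredT) //=.
apply: eq_bigr => x _; rewrite /mass (pr_historyQ (fun h =>
  avoids h && (h ord_max == x))) mulr_suml.
by apply: eq_bigr => h /andP[_ /eqP->].
Qed.

Lemma mass_start x : s \notin S -> mass 0 x = (x == s)%:R.
Proof.
move=> sS; rewrite -pr_start /mass.
have Xh w : history 0 w ord_max = X 0 w by rewrite ffunE.
have [->|xs] := eqVneq x s.
  congr pr; apply/seteqP; split=> w /=; first by rewrite Xh => /andP[_ /eqP].
  by move=> Xs; rewrite Xh Xs eqxx andbT; apply/forallP => i;
    rewrite ffunE (ord1 i) Xs.
apply/eqP; rewrite eq_le; apply/andP; split;
  last by rewrite pr_start (negbTE xs) pr_ge0.
apply: le_pr; last 1 first.
- by move=> w /=; rewrite Xh => /andP[_ /eqP].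
- exact: (measurable_historyQ (fun h => avoids h && (h ord_max == x))).
- exact: mX.
Qed.

Lemma mass_in n x : s \notin S -> x \in S -> mass n x = 0.
Proof.
move=> sS xS; case: n => [|n]; last by rewrite mass_next xS mul0r.
by rewrite mass_start //; case: eqP xS sS => // -> ->.
Qed.

Variable g : V -> R.
Hypotheses (sS : s \notin S) (g_in : {in S, forall x, g x = 0}).
Hypothesis g_out :
  forall x, x \notin S -> g x = 1 + \sum_y transition x y * g y.

(** Off [S] the equation for [g] splits the pairing into the total mass and the mass moved one step;
    what lands in [S] is killed, and [g] is 0 there. *)
Lemma mass_step n :
  \sum_x mass n x * g x = survival n + \sum_y mass n.+1 y * g y.
Proof.
transitivity (\sum_x (mass n x + \sum_y mass n x * transition x y * g y)).
  apply: eq_bigr => x _; have [xS|xS] := boolP (x \in S).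
    by rewrite mass_in // mul0r big1 ?addr0 // => y _; rewrite !mul0r.
  rewrite [in LHS]g_out // mulrDr mulr1 mulr_sumr; congr (_ + _).
  by apply: eq_bigr => y _; rewrite mulrA.
rewrite big_split -survival_sum /=; congr (_ + _).
rewrite exchange_big; apply: eq_bigr => y _ /=; rewrite -mulr_suml mass_next.
by have [yS|yS] := boolP (y \in S); rewrite ?mul1r // (g_in yS) !mulr0.
Qed.

Lemma survival_partial N :
  \sum_(n < N) survival n = g s - \sum_y mass N y * g y.
Proof.
elim: N => [|N IHN].
  rewrite big_ord0 (bigD1 s) //= mass_start // eqxx mul1r big1 ?addr0 ?subrr //.
  by move=> x /negbTE xs; rewrite mass_start // xs mul0r.
by rewrite big_ord_recr /= IHN mass_step opprD addrA addrAC subrK.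
Qed.

Let C := \sum_x `|g x|.

Lemma mass_bound N : `|\sum_y mass N y * g y| <= C * survival N.
Proof.
rewrite survival_sum mulr_sumr; apply: le_trans (ler_norm_sum _ _ _) _.
apply: ler_sum => y _; rewrite normrM ger0_norm ?mass_ge0 // mulrC.
apply: ler_wpM2r; first exact: mass_ge0.
by rewrite /C (bigD1 y) //= lerDl sumr_ge0.
Qed.

Lemma survival_le1 N : survival N <= 1.
Proof.
rewrite -lee_fin prK; last exact: measurable_historyQ.
by apply: probability_le1; exact: measurable_historyQ.
Qed.

Lemma survival_harmonic N : survival N <= 2 * C * harmonic N.
Proof.
have C0 : 0 <= C by exact: sumr_ge0.
rewrite /= ler_pdivlMr // mulrC.
(* Survival decreases, so each of these N + 1 terms is at least [survival N]. *)
apply: (@le_trans _ _ (\sum_(n < N.+1) survival n)).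
  rewrite mulr_natl -[X in _ *+ X](card_ord N.+1) -sumr_const.
  apply: ler_sum => -[i /= iN] _.
  have /(_ i N iN) // : {homo survival : m n / (m <= n)%N >-> n <= m}.
  apply: homo_leq => // [a b e ab|a]; last exact: survival_decr.
  by move=> h; exact: le_trans h ab.
rewrite survival_partial mulr_natl mulr2n.
(* One [C] bounds g(s), the other the remainder, as survival is at most 1. *)
apply: le_trans (ler_norm _) _; apply: le_trans (ler_normB _ _) _.
apply: lerD; first by rewrite /C (bigD1 s) //= lerDl sumr_ge0.
apply: le_trans (mass_bound _) _; rewrite -[leRHS]mulr1.
by apply: ler_wpM2l => //; exact: survival_le1.
Qed.

Lemma cvg_survival : \sum_(n < N) survival n @[N --> \oo] --> g s.
Proof.
have C0 : 0 <= C by exact: sumr_ge0.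
rewrite -[g s]subr0.
under eq_cvg do rewrite survival_partial.
apply: cvgB; first exact: cvg_cst.
apply: norm_cvg0.
apply: (@squeeze_cvgr _ _ _ _ (fun=> 0) (fun N => C * (2 * C) * harmonic N)).
- near=> N; rewrite normr_ge0 /= (le_trans (mass_bound _)) // -mulrA.
  by apply: ler_wpM2l => //; exact: survival_harmonic.
- exact: cvg_cst.
- rewrite -[X in _ --> X](mulr0 (C * (2 * C))).
  by apply: cvgM; [exact: cvg_cst|exact: cvg_harmonic].
Unshelve. all: by end_near.
Qed.

End Avoid.
End Walk.

(** * Cover times *)

Section CoverTime.
Local Open Scope classical_set_scope.
Context {R : realType} {V : finType} (c : V -> V -> R) (s : V).
Context d (T : measurableType d) (P : probability T R) (X : nat -> T -> V).
Hypothesis walk : is_random_walk c s P X.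
Local Notation pr := (prob P).

Definition unvisited n (h : {ffun 'I_n.+1 -> V}) : {set V} :=
  [set x | [forall i, h i != x]]%SET.

Definition uncovered n : set T :=
  [set w | unvisited (history X n w) != finset.set0].

Lemma measurable_uncovered n : measurable (uncovered n).
Proof. exact: (measurable_historyQ walk (fun h =>
  unvisited h != finset.set0)). Qed.

Lemma unvisitedP n x w :
  reflect (forall i, (i <= n)%N -> X i w <> x) (x \in unvisited (history X n
    w)).
Proof.
rewrite inE; apply: (iffP forallP) => [av i lin|av i].
  by have := av (Ordinal (lin : (i < n.+1)%N)); rewrite ffunE => /eqP.
by rewrite ffunE; apply/eqP/av; rewrite -ltnS.
Qed.

Lemma coveredP n w :
  ~ uncovered n w <-> forall x, exists2 i, (i <= n)%N & X i w = x.
Proof.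
split=> [/negP|cov].
  rewrite negbK => /eqP U0 x.
  have : x \notin unvisited (history X n w) by rewrite U0 inE.
  move/unvisitedP => nav; apply: contrapT => nex; apply: nav => i lin Xi.
  by apply: nex; exists i.
move=> /finset.set0Pn[x /unvisitedP av]; have [i lin] := cov x.
exact: av.
Qed.

Lemma uncovered_decr m n : (m <= n)%N -> uncovered n `<=` uncovered m.
Proof.
move=> mn w un; apply: contrapT => /coveredP cov; move: un.
apply/coveredP => x; have [i lim Xi] := cov x; exists i => //.
exact: leq_trans mn.
Qed.

Lemma sum_uncovered w N : (forall n, (n < N)%N -> uncovered n w) ->
  \sum_(0 <= n < N) (\1_(uncovered n) w)%:E = N%:R%:E :> \bar R.
Proof.
move=> unc; rewrite sumEFin big_nat (eq_bigr (fun=> 1)) => [|n /andP[_ nN]].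
  by rewrite -big_nat sumr_const_nat subn0.
by rewrite indicE mem_set //; exact: unc.
Qed.

(** The cover time counts the times n at which some vertex is still missing. *)
Lemma cover_time_series w :
  cover_time X w = (\sum_(0 <= n <oo) (\1_(uncovered n) w)%:E)%E :> \bar R.
Proof.
have pos n : (0%N <= n)%N -> true -> (0 <= (\1_(uncovered n) w)%:E :> \bar R)%E.
  by move=> _ _; rewrite lee_fin.
have [[N covN]|allunc] := pselect (exists N, ~ uncovered N w).
  have exN : exists N, `[< ~ uncovered N w >] by exists N; apply/asboolP.
  (* [M] is the first covering time: the indicators are 1 before it and 0 from it on. *)
  have [M /asboolP covM minM] := ex_minnP exN.
  have unc n : (n < M)%N -> uncovered n w.
    by move=> nM; apply: contrapT => /asboolP /minM; rewrite leqNgt nM.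
  have -> : (\sum_(0 <= n <oo) (\1_(uncovered n) w)%:E)%E = M%:R%:E :> \bar R.
    apply: cvg_lim => //; apply: cvg_near_cst.
    exists M => // n /= Mn;
      rewrite (big_cat_nat (leq0n _) Mn) //= sum_uncovered //.
    rewrite big_nat big1 ?adde0 // => i /andP[Mi _].
    rewrite indicE memNset //; apply: contra_not covM => ui.
    exact: (uncovered_decr Mi).
  apply/eqP; rewrite eq_le; apply/andP; split.
    by apply: ereal_inf_lbound; exists M => //; exact/coveredP.
  apply: le_ereal_inf_tmp => _ [n /= cov <-].
  by rewrite lee_fin ler_nat; apply: minM; apply/asboolP/coveredP.
have unc n : uncovered n w.
  by apply: contrapT => covn; apply: allunc; exists n.
(* When V is never covered the series diverges, matching the infimum of the empty set. *)
have -> : (\sum_(0 <= n <oo) (\1_(uncovered n) w)%:E)%E = +oo%E :> \bar R.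
  apply: cvg_lim => //; under eq_cvg do rewrite sum_uncovered //.
  by apply/cvgeryP; exact: cvgr_idn.
rewrite /cover_time; have -> : [set n : nat | forall x, exists2 i, (i <=
  n)%N & X i w = x] = set0.
  apply/seteqP; split=> // n /= /coveredP; exact.
by rewrite image_set0 ereal_inf0.
Qed.

Lemma integral_cover_time :
  (\int[P]_w cover_time X w = \sum_(0 <= n <oo) P (uncovered n))%E.
Proof.
under eq_integral do rewrite cover_time_series.
rewrite integral_nneseries //.
- apply: eq_eseriesr => n _; rewrite integral_indic // ?setIT //.
  exact: measurable_uncovered.
- move=> n; apply/measurable_realfun.measurable_EFinP.
  apply: measurable_realfun.measurable_indic.
  exact: measurable_uncovered.
Qed.

(** A history avoids S exactly when S lies in its unvisited set, so inclusion-exclusion applies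
    history by history. *)
Lemma pr_uncovered n :
  pr (uncovered n) = \sum_(S in admissible s) epsS R S * survival P X S n.
Proof.
rewrite /uncovered (pr_historyQ walk (fun h => unvisited h != finset.set0)).
rewrite /survival.
under [RHS]eq_bigr do rewrite (pr_historyQ walk) mulr_sumr big_mkcond /=.
rewrite exchange_big big_mkcond /=; apply: eq_bigr => h _.
(* Histories not starting at s have probability 0; the others have visited s, as
   [sum_admissible_subset] requires. *)
have [h0|h0] := eqVneq (h ord0) s; last first.
  have q0 : pr [set w | history X n w = h] = 0.
    apply/eqP; rewrite eq_le pr_ge0 andbT.
    have <- : pr [set w | X 0%N w = h ord0] = 0.
      by rewrite (pr_start walk) (negbTE h0).
    apply: le_pr; [exact: (measurable_history walk)|exact: (mX walk)|].
    by move=> w /= <-; rewrite ffunE.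
  rewrite q0 if_same big1 // => S _; by rewrite mulr0 if_same.
have sU : s \notin unvisited h.
  by rewrite inE; apply/forallPn; exists ord0; rewrite h0 eqxx.
transitivity ((unvisited h != finset.set0)%:R * pr [set w | history X n w = h]).
  by case: ifP => _; rewrite ?mul1r ?mul0r.
rewrite -(sum_admissible_subset R sU) mulr_suml; apply: eq_bigr => S _.
have -> : avoids S h = (S \subset unvisited h).
  apply/forallP/fintype.subsetP => [av x xS|SU i].
    by rewrite inE; apply/forallP => i; apply: contraTneq xS => <-.
  by apply/negP => /SU; rewrite inE => /forallP/(_ i); rewrite eqxx.
by case: ifP => _; rewrite ?mulr1 ?mulr0 ?mul0r.
Qed.

(** [cvg_survival] sums the tails for each S to [g S s], and the finite signed sum over S commutes
    with the limit. *)
Lemma expected_cover_time (g : {set V} -> V -> R) :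
  (forall S, S \in admissible s ->
     {in S, forall x, g S x = 0} /\
     forall x, x \notin S -> g S x = 1 + \sum_y transition c x y * g S y) ->
  (\int[P]_w cover_time X w)%E = (\sum_(S in admissible s) epsS R S * g S s)%:E.
Proof.
move=> gP; rewrite integral_cover_time.
apply: cvg_lim => //.
under eq_cvg => N.
  have -> : (\sum_(0 <= n < N) P (uncovered n))%E =
      (\sum_(S in admissible s) epsS R S * \sum_(n < N) survival P X S n)%:E.
    rewrite big_mkord; under eq_bigr => n _.
      rewrite -prK; last exact: measurable_uncovered.
      rewrite pr_uncovered; over.
    rewrite sumEFin exchange_big /=; congr EFin.
    by apply: eq_bigr => S _; rewrite mulr_sumr.
  over.
apply: cvg_EFin; first by apply: nearW.
apply: cvg_big => [|S SA]; first exact: add_continuous.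
apply: cvgM; first exact: cvg_cst.
have [g_in g_out] := gP S SA.
apply: (cvg_survival walk _ g_in g_out).
exact: admissible_notin.
Qed.

End CoverTime.

(** * Difference quotient of the expected cover time and its poles *)

Theorem theorem4p3 (R : realType) (V : finType) (E : rel V)
    (Esym : symmetric E) (Eirr : irreflexive E)
    (Econn : forall x y : V, connect E x y)
    (u v s : V) (neq_uv : u != v) (nEuv : ~~ E u v)
    (f : R -> \bar R)
    (f_cover : forall lambda : R, 0 <= lambda ->
       is_expected_cover_time (conductance E u v lambda) s (f lambda)) :
  let quot (lambda : R) : \bar R := ((f lambda - f 0%R) * (lambda^-1)%:E)%E in
  [/\ forall lambda : R, 0 < lambda ->
        quot lambda =
        (ell R E u v s +
         \sum_(rho <- Rs R E u v s) coef E u v s rho / (1 + rho * lambda))%:E,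
      forall F : {fraction {poly R}},
        agrees_on_pos F quot <-> F = partial_fractions R E u v s &
      forall (z : R[i]) (k : nat),
        is_pole (partial_fractions R E u v s) z k -> k = 1%N /\ z < 0].
Proof.
move=> quot.
have fE l : 0 <= l ->
    f l = (\sum_(S in admissible s) epsS R S * hitting E u v S l s)%:E.
  move=> l0; have [d [T [P [X [walk ->]]]]] := f_cover l l0.
  apply: (expected_cover_time walk (g := fun S => hitting E u v S l)) =>
    S /admissible_neq0 S0; split.
    by move=> x; exact: hitting_out.
  by move=> x xS; exact: hitting_harmonic.
have quotE l : 0 < l -> quot l =
    (ell R E u v s +
     \sum_(rho <- Rs R E u v s) coef E u v s rho / (1 + rho * l))%:E.
  (* Both expectations are finite by [fE], so the extended-real quotient is a real one. *)
  move=> l0; rewrite /quot !fE ?(ltW l0) // -EFinB -EFinM; congr EFin.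
  rewrite -sum_quot_term // -sumrB mulr_suml; apply: eq_bigr => S SA.
  rewrite -mulrBr hitting_quot ?(admissible_neq0 SA) ?(ltW l0) //.
  by rewrite -mulrA mulrAC divff ?mul1r // gt_eqF.
split=> //.
- by move=> F; apply: agrees_on_posP => //; exact: Rs_gt0.
- by move=> z k; apply: pole_pf_sum; [exact: Rs_gt0|exact: Rs_uniq].
Qed.
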